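(* Let $V$ be a finite set, let $X,Y$ be disjoint subsets of $V$, and let $N$ be a Lagrangian chain-group on $V$ to $K$. The following are equivalent: (i) $\lambda_N(Z)\ge k$ for all sets $Z$ with $X\subseteq Z\subseteq V\setminus Y$; (ii) there is a minor $M$ of $N$ on $X\cup Y$ such that $\lambda_M(X)\ge k$. In other words, \[\min\{\lambda_N(Z): X\subseteq Z\subseteq V\setminus Y\}=\max\{\lambda_{N\setminus U/W}(X): U\cup W=V\setminus(X\cup Y),\ U\cap W=\emptyset\}.\]
   Context: $\mathbb{F}$ is a field, $K=\mathbb{F}^2$ with bilinear form $\langle\,,\,\rangle_K$ either $b^+(\binom ab,\binom cd)=ad+bc$ or $b^-(\binom ab,\binom cd)=ad-bc$. Chains on $V$ to $K$ are maps $V\to K$, forming $K^V$ with $\langle f,g\rangle=\sum_x\langle f(x),g(x)\rangle_K$. A chain-group is a subspace of $K^V$; it is Lagrangian if $\langle f,g\rangle=0$ for all $f,g\in N$ and $\dim N=|V|$. For $T\subseteq V$: $f\cdot T$ is restriction; $N\times T=\{f\cdot T:f\in N, f(x)=0\ \forall x\notin T\}$; $N\setminus T=\{f\cdot(V\setminus T): f\in N,\ \langle f(x),\binom10\rangle_K=0\ \forall x\in T\}$; $N/T=\{f\cdot(V\setminus T): f\in N,\ \langle f(x),\binom01\rangle_K=0\ \forall x\in T\}$. A minor of $N$ is $N/X'\setminus Y'$ for disjoint $X',Y'$. The connectivity function of a chain-group $N$ on $V$ is $\lambda_N(U)=\frac12(\dim N-\dim(N\times(V\setminus U))-\dim(N\times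 U))$. *)

(* Defs.v *)
From HB Require Import structures.
From mathcomp Require Import all_boot all_order all_algebra.
Set Implicit Arguments.
Unset Strict Implicit.
Unset Printing Implicit Defensive.
Import Order.TTheory GRing.Theory Num.Theory.
Local Open Scope ring_scope.

Definition vec2 (F : fieldType) (a b : F) : 'cV[F]_2 :=
  \col_(i < 2) (if i == ord0 then a else b).

Definition bplus (F : fieldType) (u v : 'cV[F]_2) : F :=
  u ord0 ord0 * v ord_max ord0 + u ord_max ord0 * v ord0 ord0.

Definition bminus (F : fieldType) (u v : 'cV[F]_2) : F :=
  u ord0 ord0 * v ord_max ord0 - u ord_max ord0 * v ord0 ord0.

(* The two admissible forms on K = F^2; [F^o] is F seen as a vector space. *)
Definition formK (F : fieldType) (skew : bool) (u v : 'cV[F]_2) : F^o :=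
  if skew then bminus u v else bplus u v.

(* Ground sets are subsets S of an ambient finite type E, so that a chain-group
   and all its minors live over the same E, each with its own space K^S. *)
Definition chain (F : fieldType) (E : finType) (S : {set E}) :=
  {ffun {x : E | x \in S} -> 'cV[F]_2}.

Notation chain_group F S := {vspace (chain F S)}.

Definition form_chain (F : fieldType) (E : finType) (skew : bool)
    (S : {set E}) (f g : chain F S) : F :=
  \sum_x formK skew (f x) (g x).

Definition lagrangian (F : fieldType) (E : finType) (skew : bool)
    (S : {set E}) (N : chain_group F S) : Prop :=
  (forall f g : chain F S, f \in N -> g \in N -> form_chain skew f g = 0)
  /\ \dim N = #|S|.

(* The restriction f . T, meant for T \subset S; a point of T outside S gets
   the value 0. *)
Definition restrict (F : fieldType) (E : finType) (S T : {set E})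
    (f : chain F S) : chain F T :=
  [ffun x : {x : E | x \in T} =>
     if insub (val x) is Some y then f y else 0 : 'cV[F]_2].

(* The maps passed to [linfun] below are linear; the sets of chains thus
   obtained are given by the lemmas at the end of the file. *)
Definition cg_times (F : fieldType) (E : finType) (S : {set E})
    (N : chain_group F S) (T : {set E}) : chain_group F T :=
  (linfun (@restrict F E S T) @:
     (N :&: \bigcap_(x : {x : E | x \in S} | val x \notin T)
              lker (linfun (fun f : chain F S => f x))))%VS.

Definition cg_minor_by (F : fieldType) (E : finType) (skew : bool)
    (e : 'cV[F]_2) (S : {set E}) (N : chain_group F S) (T : {set E}) :
    chain_group F (S :\: T) :=
  (linfun (@restrict F E S (S :\: T)) @:
     (N :&: \bigcap_(x : {x : E | x \in S} | val x \in T)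
              lker (linfun (fun f : chain F S => formK skew (f x) e))))%VS.

Definition cg_delete (F : fieldType) (E : finType) (skew : bool)
    (S : {set E}) (N : chain_group F S) (T : {set E}) :=
  cg_minor_by skew (vec2 1 0) N T.

Definition cg_contract (F : fieldType) (E : finType) (skew : bool)
    (S : {set E}) (N : chain_group F S) (T : {set E}) :=
  cg_minor_by skew (vec2 0 1) N T.

Inductive is_minor (F : fieldType) (E : finType) (skew : bool)
    (S : {set E}) (N : chain_group F S) :
    forall S' : {set E}, chain_group F S' -> Prop :=
| IsMinor (X' Y' : {set E}) of X' \subset S & Y' \subset S
    & [disjoint X' & Y'] :
    is_minor skew N (cg_delete skew (cg_contract skew N X') Y').

(* Rational-valued: the factor 1/2 is exact even for a chain-group that is not
   Lagrangian. *)
Definition connectivity (F : fieldType) (E : finType) (S : {set E})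
    (N : chain_group F S) (U : {set E}) : rat :=
  ((\dim N)%:R - (\dim (cg_times N (S :\: U)))%:R - (\dim (cg_times N U))%:R)
  / 2%:R.

Section Membership.
Variables (F : fieldType) (E : finType) (skew : bool).

Lemma vec2E (a b : F) :
  (vec2 a b ord0 ord0 = a) * (vec2 a b ord_max ord0 = b).
Proof. by rewrite !mxE. Qed.

Lemma restrictE (S T : {set E}) (f : chain F S) (x : E)
    (xS : x \in S) (xT : x \in T) :
  restrict T f (exist _ x xT) = f (exist _ x xS).
Proof.
rewrite ffunE /=; case: insubP => [y _ yx|]; last by rewrite xS.
by congr (f _); apply: val_inj.
Qed.

Lemma restrict_linear (S T : {set E}) : linear (@restrict F E S T).
Proof.
move=> a f g; apply/ffunP => x; rewrite !ffunE.
by case: insub => [y|]; rewrite ?ffunE // scaler0 addr0.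
Qed.

Lemma eval_linear (S : {set E}) (x : {x : E | x \in S}) :
  linear (fun f : chain F S => f x).
Proof. by move=> a f g; rewrite !ffunE. Qed.

Lemma form_eval_linear (S : {set E}) (x : {x : E | x \in S}) (e : 'cV[F]_2) :
  linear (fun f : chain F S => formK skew (f x) e).
Proof.
move=> a f g; rewrite !ffunE /formK /bplus /bminus /GRing.scale /= !mxE.
case: skew; rewrite !mulrDl ?mulrBr ?mulrDr ?opprD -!mulrA.
  by rewrite -!addrA; congr (_ + _); rewrite addrCA.
by rewrite -!addrA; congr (_ + _); rewrite addrCA.
Qed.

Lemma linfunE (aT rT : vectType F) (f : aT -> rT) : linear f -> linfun f =1 f.
Proof.
move=> lf; pose m := GRing.isLinear.Build _ _ _ _ f lf.
pose g : {linear aT -> rT} := HB.pack f m.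
exact: (lfunE g).
Qed.

Lemma mem_cg_times (S : {set E}) (N : chain_group F S) (T : {set E})
    (g : chain F T) :
  g \in cg_times N T <->
  exists f : chain F S,
    [/\ f \in N,
        forall x : {x : E | x \in S}, val x \notin T -> f x = 0
      & g = restrict T f].
Proof.
split=> [/memv_imgP [f fN ->]|[f [fN f0 ->]]].
  exists f; move: fN; rewrite memv_cap => /andP[fN /subv_bigcapP fT].
  split=> // [x xT|]; last by rewrite linfunE //; exact: restrict_linear.
  have := fT x xT; rewrite -memvE memv_ker linfunE; last exact: eval_linear.
  by move/eqP.
apply/memv_imgP; exists f; last by rewrite linfunE //; exact: restrict_linear.
rewrite memv_cap fN /=; apply/subv_bigcapP => x xT.
rewrite -memvE memv_ker linfunE; last exact: eval_linear.
by rewrite f0.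
Qed.

Lemma mem_cg_minor_by (e : 'cV[F]_2) (S : {set E}) (N : chain_group F S)
    (T : {set E}) (g : chain F (S :\: T)) :
  g \in cg_minor_by skew e N T <->
  exists f : chain F S,
    [/\ f \in N,
        forall x : {x : E | x \in S}, val x \in T -> formK skew (f x) e = 0
      & g = restrict (S :\: T) f].
Proof.
split=> [/memv_imgP [f fN ->]|[f [fN f0 ->]]].
  exists f; move: fN; rewrite memv_cap => /andP[fN /subv_bigcapP fT].
  split=> // [x xT|]; last by rewrite linfunE //; exact: restrict_linear.
  have := fT x xT; rewrite -memvE memv_ker linfunE; last exact: form_eval_linear.
  by move/eqP.
apply/memv_imgP; exists f; last by rewrite linfunE //; exact: restrict_linear.
rewrite memv_cap fN /=; apply/subv_bigcapP => x xT.
rewrite -memvE memv_ker linfunE; last exact: form_eval_linear.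
by rewrite f0.
Qed.

End Membership.

(* Main.v *)
(** For an isotropic subspace [J], sending [L] to (L :&: J^perp) + J carries
    isotropic subspaces to isotropic subspaces without lowering the dimension.
    Taking [J] spanned by a vector (1,0) at each point of [A] and (0,1) at each
    point of [T :\: A], the chains of the image that vanish on [T] form the minor
    deleting [A] and contracting [T :\: A]; so all minors can be compared inside
    one space K^E, where lambda_L(U) = |U| - dim (L x U).

    Applied to the isotropic space L x Z with X <= Z <= X :|: T, the dimension
    bound says that no minor has larger connectivity at [X] than [L] has at [Z].
    Conversely, if [J1] and [J2] are complementary Lagrangian subspaces of K^T and
    [L1], [L2] the images of [L], then
      lambda_L(X :&: Y) + lambda_L(X :|: Y :|: T)
        <= lambda_L1(X) + lambda_L2(Y) + |T|.
    For a single point [T] this shows that deletion or contraction keeps the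
    minimum of lambda over the separating sets, so that all points outside the
    two given sets can be removed one at a time. *)

Require Import Defs.
From HB Require Import structures.
From mathcomp Require Import all_boot all_order all_algebra.
From mathcomp Require Import zify ring.
Set Implicit Arguments.
Unset Strict Implicit.
Unset Printing Implicit Defensive.
Import Order.TTheory GRing.Theory Num.Theory.
Local Open Scope ring_scope.

Lemma bigmin_eq_bigmax (disp : Order.disp_t) (R : orderType disp)
    (I J : finType) (P : pred I) (Q : pred J) (f : I -> R) (g : J -> R)
    (i0 i1 : I) (j0 j1 : J) :
    P i0 -> P i1 -> Q j0 -> Q j1 ->
    (forall i j, P i -> Q j -> (g j <= f i)%O) -> (f i1 <= g j1)%O ->
  \big[Order.min/f i0]_(i | P i) f i = \big[Order.max/g j0]_(j | Q j) g j.
Proof.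
move=> Pi0 Pi1 Qj0 Qj1 le_gf le_fg; apply/le_anti/andP; split.
  by apply: (bigmin_inf i1) => //; apply: (bigmax_sup j1).
apply: bigmax_le => [|j Qj]; apply: le_bigmin => [|i Pi]; exact: le_gf.
Qed.

Lemma disjoint_setD (T : finType) (A B : {set T}) : [disjoint A & B :\: A].
Proof. by rewrite disjoint_sym disjoints_subset setDE subsetIr. Qed.

(** * Reduction of a subspace by an isotropic subspace *)

Section IsotropicReduction.
Variables (F : fieldType) (eps : bool) (theta : {rmorphism F -> F}).
Variables (vT : vectType F) (form : {hermitian vT for eps & theta}).
Implicit Types U V W J : {vspace vT}.

Local Notation perp := (orthov form).

Definition isotropic W : bool := (W <= perp W)%VS.

(* Stands for the quotient of [W :&: perp J] by its part in [J], represented by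
   its preimage so that it stays in the same space. *)
Definition reduction J W : {vspace vT} := (W :&: perp J + J)%VS.

Lemma isotropicS V W : (V <= W)%VS -> isotropic W -> isotropic V.
Proof.
move=> VW /orthovP W0; apply/orthovP => u v uV vV.
by rewrite W0 ?(subvP VW).
Qed.

Lemma orthov_addv V W : perp (V + W) = (perp V :&: perp W)%VS.
Proof. by apply/vspaceP => u; rewrite memv_cap !memvE orthovD. Qed.

Lemma orthovS V W : (V <= W)%VS -> (perp W <= perp V)%VS.
Proof. by move=> /addv_idPr <-; rewrite orthov_addv capvSl. Qed.

Lemma leq_dim_orthov V W : (\dim V <= \dim (V :&: perp W) + \dim W)%N.
Proof.
suff leq_dim_span (X : seq vT) U :
    (\dim U <= \dim (U :&: perp <<X>>) + size X)%N.
  have := leq_dim_span (vbasis W) V.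
  by rewrite (span_basis (vbasisP W)) size_tuple.
elim: X U => [|x X IH] U /=; first by rewrite span_nil orthov0 capvf addn0.
rewrite span_cons orthov_addv capvA; have := leq_dim_orthov1 form x U.
by have := IH (U :&: perp <[x]>)%VS; lia.
Qed.

Lemma leq_dim_orthogonal U V W :
    (U :&: perp U = 0)%VS -> (V <= U)%VS -> (W <= U)%VS -> (V <= perp W)%VS ->
  (\dim V + \dim W <= \dim U)%N.
Proof.
move=> U0 VU WU VW; rewrite -(dimv_cap_compl U V) (capv_idPr VU) leq_add2l.
have perpU : perp U = (perp (U :\: V) :&: perp V)%VS.
  by rewrite -orthov_addv addv_diff; have /addv_idPl -> := VU.
suff WC0 : (W :&: perp (U :\: V) = 0)%VS.
  by have := leq_dim_orthov W (U :\: V); rewrite WC0 dimv0.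
apply/eqP; rewrite -subv0 -U0 perpU !subv_cap capvSr.
by rewrite !(subv_trans (capvSl _ _)) // orthov_sym.
Qed.

Lemma isotropic_reduction J W :
  isotropic J -> isotropic W -> isotropic (reduction J W).
Proof.
move=> J0 /(isotropicS (capvSl W (perp J))) WJ0.
rewrite /isotropic orthoDv !orthovD -!/(isotropic _) WJ0 J0 capvSr andbT /=.
by rewrite orthov_sym capvSr.
Qed.

Lemma leq_dim_reduction J W :
  isotropic W -> (\dim W <= \dim (reduction J W))%N.
Proof.
move=> W0; set C := (J :\: W)%VS.
have W_perpC : (W :&: perp C <= W :&: perp J)%VS.
  rewrite -(addv_diff_cap J W) orthov_addv !subv_cap capvSl capvSr /=.
  by rewrite (subv_trans (capvSl _ _)) // orthov_sym (subv_trans (capvSr _ _)).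
have := leq_dim_orthov W C; have := dimvS W_perpC.
have capJ : (W :&: perp J :&: J <= J :&: W)%VS.
  by rewrite subv_cap capvSr (subv_trans (capvSl _ _)) ?capvSl.
have := dimvS capJ; have := dimv_cap_compl J W.
have := dimv_sum_cap (W :&: perp J) J; rewrite -/(reduction J W) -/C; lia.
Qed.

Lemma reduction0v W : reduction 0 W = W.
Proof. by rewrite /reduction orthov0 capvf addv0. Qed.

Lemma reductionS J V W : (V <= W)%VS -> (reduction J V <= reduction J W)%VS.
Proof. by move=> VW; rewrite addvS // capvS. Qed.

Lemma reduction_capv J U W :
  (J <= U)%VS -> (reduction J (W :&: U) = reduction J W :&: U)%VS.
Proof.
move=> JU; rewrite /reduction -capvA (capvC U) capvA (capvC _ U).
by rewrite vspace_modr // capvC.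
Qed.

Lemma reductionD J1 J2 W : (J1 <= perp J2)%VS ->
  reduction (J1 + J2) W = reduction J2 (reduction J1 W).
Proof.
move=> J12; rewrite /reduction orthov_addv addvA capvA.
by rewrite [in RHS]capvC -vspace_modr // [in RHS]capvC.
Qed.

Lemma reduction_addvS J1 J2 W :
  (W <= perp J2)%VS -> (reduction J1 W <= reduction (J1 + J2) W)%VS.
Proof.
move=> WJ2; rewrite /reduction orthov_addv addvS ?addvSl //.
by rewrite !subv_cap capvSl capvSr (subv_trans (capvSl _ _)).
Qed.

End IsotropicReduction.

(** * Chain-groups as subspaces of K^E *)

Section FormK.
Variables (F : fieldType) (skew : bool).
Implicit Types u v : 'cV[F]_2.

Lemma formK_hermitian u v :
  formK skew u v = (-1) ^+ skew * idfun (formK skew v u).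
Proof.
rewrite /formK /bplus /bminus; case: skew => /=.
  by rewrite mulN1r opprB ![_ * u _ _]mulrC.
by rewrite mul1r addrC ![_ * u _ _]mulrC.
Qed.

Lemma formK_bilinear : bilinear_for
  (GRing.Scale.Law.clone _ _ *%R _) (GRing.Scale.Law.clone _ _ (idfun \; *%R) _)
  (formK skew : 'cV[F]_2 -> 'cV[F]_2 -> F).
Proof.
have linearl v : linear (fun u => formK skew u v).
  move=> a u w; rewrite /formK /bplus /bminus !mxE /GRing.scale /=.
  by case: skew; ring.
split=> [v|u] a v1 v2 /=; first exact: linearl.
by rewrite formK_hermitian /= linearl mulrDr mulrCA -!formK_hermitian.
Qed.

HB.instance Definition _ := bilinear_isBilinear.Build F _ _ _ _ _
  (formK skew : 'cV[F]_2 -> 'cV[F]_2 -> F) formK_bilinear.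
HB.instance Definition _ := isHermitianSesquilinear.Build F _ skew idfun
  (formK skew : 'cV[F]_2 -> 'cV[F]_2 -> F) formK_hermitian.

End FormK.

Section ChainGroups.
Variables (F : fieldType) (E : finType) (skew : bool).

Local Notation K := 'cV[F]_2.
Local Notation KE := {ffun E -> K}.
(* Named because [lia] only identifies the dimensions of subspaces of K^E when
   they all refer to syntactically the same vector space. *)
Definition ambient : vectType F := {ffun E -> K}.
Implicit Types (A B S T U X Y Z : {set E}) (f g h : KE) (J L : {vspace ambient}).

Definition ambient_form f g : F := \sum_x formK skew (f x) (g x).

Lemma ambient_form_hermitian f g :
  ambient_form f g = (-1) ^+ skew * idfun (ambient_form g f).
Proof.
by rewrite /= mulr_sumr; apply: eq_bigr => x _; rewrite formK_hermitian.
Qed.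

Lemma ambient_form_bilinear : bilinear_for
  (GRing.Scale.Law.clone _ _ *%R _) (GRing.Scale.Law.clone _ _ (idfun \; *%R) _)
  ambient_form.
Proof.
split=> [g|f] a f1 f2 /=; rewrite mulr_sumr -big_split;
  apply: eq_bigr => x _; rewrite !ffunE.
- exact: linearPl.
- exact: linearPr.
Qed.

HB.instance Definition _ :=
  bilinear_isBilinear.Build F _ _ _ _ _ ambient_form ambient_form_bilinear.
HB.instance Definition _ :=
  isHermitianSesquilinear.Build F _ skew idfun ambient_form ambient_form_hermitian.

Local Notation form := (ambient_form : {hermitian ambient for skew & idfun}).
Local Notation perp := (orthov form).
Local Notation isotropic := (isotropic form).
Local Notation reduction := (reduction form).

Definition extend S (f : chain F S) : KE :=
  [ffun x => if insub x is Some y then f y else 0].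

Lemma extend_is_linear S : linear (@extend S).
Proof.
move=> a f g; apply/ffunP => x; rewrite !ffunE.
by case: insub => [y|]; rewrite ?ffunE // scaler0 addr0.
Qed.

HB.instance Definition _ S :=
  GRing.isLinear.Build F (chain F S) KE _ (@extend S) (@extend_is_linear S).

Lemma extend_val S (f : chain F S) (y : {x : E | x \in S}) :
  extend f (val y) = f y.
Proof. by rewrite ffunE valK. Qed.

Lemma extend_out S (f : chain F S) x : x \notin S -> extend f x = 0.
Proof. by move=> xS; rewrite ffunE insubN. Qed.

Lemma extend_restrict S T (f : chain F S) :
  extend (restrict T f) = [ffun x => if x \in T then extend f x else 0].
Proof.
apply/ffunP => x; rewrite [RHS]ffunE; case: (boolP (x \in T)) => xT;
  last exact: extend_out.
by rewrite -[x]/(val (Sub x xT : {x : E | x \in T})) extend_val !ffunE.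
Qed.

Definition extend_group S (M : chain_group F S) : {vspace ambient} :=
  (linfun (@extend S) @: M)%VS.

Lemma extend_groupP S (M : chain_group F S) g :
  reflect (exists2 f, f \in M & g = extend f) (g \in extend_group M).
Proof.
by apply: (iffP memv_imgP) => -[f fM ->]; exists f; rewrite ?lfunE.
Qed.

Lemma dim_extend_group S (M : chain_group F S) : \dim (extend_group M) = \dim M.
Proof.
apply/limg_dim_eq/eqP; rewrite -subv0; apply/subvP => f.
rewrite memv_cap memv_ker lfunE memv0 => /andP[_ /eqP f0].
by apply/eqP/ffunP => y; rewrite -extend_val f0 !ffunE.
Qed.

Definition chains_on S : {vspace ambient} := extend_group (fullv : chain_group F S).

Lemma chains_onP S f :
  reflect (forall x, x \notin S -> f x = 0) (f \in chains_on S).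
Proof.
apply: (iffP (extend_groupP _ _)) => [[g _ ->] x|f0]; first exact: extend_out.
exists [ffun y => f (val y)]; first exact: memvf.
apply/ffunP => x; rewrite ffunE; case: insubP => [y _ <-|/f0//].
by rewrite ffunE.
Qed.

Lemma dim_chains_on S : \dim (chains_on S) = (2 * #|S|)%N.
Proof. by rewrite dim_extend_group dimvf /dim /= card_sig mulnC. Qed.

Definition single x (u : K) : KE := [ffun y => if y == x then u else 0].

Lemma ambient_form_single f x u : ambient_form f (single x u) = formK skew (f x) u.
Proof.
rewrite /ambient_form (bigD1 x) //= ffunE eqxx big1 ?addr0 // => y yx.
by rewrite ffunE (negbTE yx) linear0r.
Qed.

Lemma chains_on_single x u S : x \in S -> single x u \in chains_on S.
Proof.
move=> xS; apply/chains_onP => y yS; rewrite ffunE.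
by case: eqP yS => // ->; rewrite xS.
Qed.

Lemma chains_onS S T : S \subset T -> (chains_on S <= chains_on T)%VS.
Proof.
move=> /subsetP ST; apply/subvP => f /chains_onP f0; apply/chains_onP => x xT.
by rewrite f0 //; apply: contraNN xT => /ST.
Qed.

Lemma chains_onI S T : (chains_on S :&: chains_on T)%VS = chains_on (S :&: T).
Proof.
apply/eqP; rewrite eqEsubv subv_cap !chains_onS ?subsetIl ?subsetIr // !andbT.
apply/subvP => f; rewrite memv_cap => /andP[/chains_onP fS /chains_onP fT].
by apply/chains_onP => x; rewrite inE negb_and => /orP[/fS|/fT].
Qed.

Lemma chains_on0 : chains_on set0 = 0%VS.
Proof. by apply/eqP; rewrite -dimv_eq0 dim_chains_on cards0. Qed.

Lemma chains_onU S T : chains_on (S :|: T) = (chains_on S + chains_on T)%VS.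
Proof.
apply/eqP; rewrite eqEsubv subv_add !chains_onS ?subsetUl ?subsetUr // !andbT.
apply/subvP => f /chains_onP f0.
apply/memv_addP; exists [ffun x => if x \in S then f x else 0].
  by apply/chains_onP => x /negbTE xS; rewrite ffunE xS.
exists [ffun x => if x \in S then 0 else f x].
  apply/chains_onP => x xT; rewrite ffunE; case: ifPn => // xS.
  by rewrite f0 // inE negb_or xS.
by apply/ffunP => x; rewrite !ffunE; case: ifP; rewrite ?addr0 ?add0r.
Qed.

Lemma chains_on_orthogonal S T J :
  [disjoint S & T] -> (J <= chains_on T)%VS -> (chains_on S <= perp J)%VS.
Proof.
move=> dST /subvP JT; apply/orthovP => f g /chains_onP f0 /JT/chains_onP g0.
apply: big1 => x _; have [xS|/f0 ->] := boolP (x \in S); last exact: linear0l.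
by rewrite g0 ?linear0r // (disjointFr dST).
Qed.

Definition axis (b : bool) : K := if b then vec2 1 0 else vec2 0 1.

Lemma formK_axis (b : bool) (u : K) :
  (formK skew u (axis b) == 0) = (u (if b then ord_max else ord0) ord0 == 0).
Proof.
rewrite /formK /bplus /bminus; case: b; rewrite !vec2E !mulr0 !mulr1.
  by rewrite !add0r; case: skew; rewrite ?oppr_eq0.
by rewrite addr0 subr0; case: skew.
Qed.

Lemma formK_axis_nondegenerate (u : K) :
  (forall b, formK skew u (axis b) = 0) -> u = 0.
Proof.
move=> u_perp; apply/colP => i; rewrite mxE.
have /eqP := u_perp (i != ord0); rewrite formK_axis.
case: (eqVneq i ord0) => [->|i0] /eqP //= <-.
by congr (u _ _); apply: val_inj; case: i i0 => [[|[|]]].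
Qed.

Lemma chains_on_nondegenerate S : (chains_on S :&: perp (chains_on S) = 0)%VS.
Proof.
apply/eqP; rewrite -subv0; apply/subvP => f; rewrite memv_cap memv0.
case/andP=> /chains_onP f0 /mem_orthovP f_perp.
apply/eqP/ffunP => x; rewrite [RHS]ffunE.
have [xS|/f0//] := boolP (x \in S); apply: formK_axis_nondegenerate => b.
by rewrite -ambient_form_single f_perp // chains_on_single.
Qed.

Definition lagrangian_on S L : Prop :=
  [/\ (L <= chains_on S)%VS, isotropic L & \dim L = #|S|].

Lemma leq_dim_isotropic L U : isotropic L -> (\dim (L :&: chains_on U) <= #|U|)%N.
Proof.
move=> /(isotropicS (capvSl L (chains_on U))) LU0.
have LU := capvSr L (chains_on U).
by have := leq_dim_orthogonal (chains_on_nondegenerate U) LU LU LU0;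
  rewrite dim_chains_on; lia.
Qed.

Lemma orthov_lagrangian_on S L :
  lagrangian_on S L -> (chains_on S :&: perp L)%VS = L.
Proof.
case=> LS L0 dL; apply/esym/eqP.
rewrite -(geq_leqif (dimv_leqif_eq _)) ?subv_cap ?LS //.
have := leq_dim_orthogonal (chains_on_nondegenerate S) (capvSl _ _) LS (capvSr _ _).
by rewrite dim_chains_on dL; lia.
Qed.

Lemma chains_on_capv_orthov J U T :
    lagrangian_on T J -> [disjoint U & T] ->
  (chains_on (U :|: T) :&: perp J)%VS = (chains_on U + J)%VS.
Proof.
move=> lJ dUT; have [JT _ _] := lJ.
rewrite chains_onU -vspace_modl ?(orthov_lagrangian_on lJ) //.
exact: chains_on_orthogonal dUT JT.
Qed.

Lemma capv_chains_onU J L U T :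
    isotropic L -> lagrangian_on T J -> (J <= L)%VS -> [disjoint U & T] ->
  (L :&: chains_on (U :|: T))%VS = (L :&: chains_on U + J)%VS.
Proof.
move=> L0 lJ JL dUT; rewrite vspace_modr // -(chains_on_capv_orthov lJ dUT).
rewrite capvA; apply/esym/capv_idPl/(subv_trans (capvSl _ _)).
exact: subv_trans L0 (orthovS _ JL).
Qed.

Lemma dim_capv_chains_onU J L U T :
    isotropic L -> lagrangian_on T J -> (J <= L)%VS -> [disjoint U & T] ->
  \dim (L :&: chains_on (U :|: T)) = (\dim (L :&: chains_on U) + #|T|)%N.
Proof.
move=> L0 lJ JL dUT; rewrite (capv_chains_onU L0 lJ JL dUT).
have [JT _ <-] := lJ; apply/dimv_disjoint_sum/eqP.
rewrite -subv0 -chains_on0 -(disjoint_setI0 dUT) -chains_onI.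
by rewrite capvS // capvSr.
Qed.

Lemma leq_dim_reduction_capv J L U T :
    isotropic L -> lagrangian_on T J -> [disjoint U & T] ->
  (\dim (reduction J L :&: chains_on U)
     <= \dim (L :&: chains_on (U :|: T) :&: perp J))%N.
Proof.
move=> L0 lJ dUT; have [JT J0 dJ] := lJ.
have JUT : (J <= chains_on (U :|: T))%VS.
  by rewrite (subv_trans JT) // chains_onS ?subsetUr.
have := dim_capv_chains_onU (isotropic_reduction J0 L0) lJ (addvSr _ _) dUT.
rewrite -(reduction_capv _ _ JUT) -dJ.
have := dimv_add_leqif (L :&: chains_on (U :|: T) :&: perp J) J.
by rewrite -/(reduction J _) => -[]; lia.
Qed.

(** * Connectivity of reductions *)

(* The subtraction is not truncated when [L] is isotropic, by
   [leq_dim_isotropic]. *)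
Definition lambda L U : nat := (#|U| - \dim (L :&: chains_on U))%N.

Lemma lambda_complement_le S L U :
  lagrangian_on S L -> U \subset S -> (lambda L U <= lambda L (S :\: U))%N.
Proof.
move=> [LS L0 dL] US; rewrite /lambda cardsD (setIidPr US).
have LUS : (L + chains_on U <= chains_on S)%VS by rewrite subv_add LS chains_onS.
have LDS : (L :&: chains_on (S :\: U) <= chains_on S)%VS.
  exact: subv_trans (capvSl _ _) LS.
have LU_perp : (L + chains_on U <= perp (L :&: chains_on (S :\: U)))%VS.
  rewrite orthoDv (subv_trans L0) ?orthovS ?capvSl //=.
  by rewrite (chains_on_orthogonal (disjoint_setD U S)) ?capvSr.
have := leq_dim_orthogonal (chains_on_nondegenerate S) LUS LDS LU_perp.
have := dimv_sum_cap L (chains_on U); rewrite !dim_chains_on dL.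
by have := subset_leq_card US; lia.
Qed.

Lemma lambda_complement S L U :
  lagrangian_on S L -> U \subset S -> lambda L (S :\: U) = lambda L U.
Proof.
move=> lL US; apply/eqP; rewrite eqn_leq (lambda_complement_le lL US) andbT.
have := lambda_complement_le lL (subsetDl S U).
by rewrite setDDr setDv set0U (setIidPr US).
Qed.

Lemma lambda_setU J L U T :
    isotropic L -> lagrangian_on T J -> (J <= L)%VS -> [disjoint U & T] ->
  lambda L (U :|: T) = lambda L U.
Proof.
move=> L0 lJ JL dUT; rewrite /lambda (dim_capv_chains_onU L0 lJ JL dUT).
by rewrite cardsU disjoint_setI0 // cards0 subn0 subnDr.
Qed.

Lemma chains_on_capv_orthov2 J1 J2 U T :
    lagrangian_on T J1 -> lagrangian_on T J2 -> (J1 :&: J2 = 0)%VS ->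
    [disjoint U & T] ->
  (chains_on (U :|: T) :&: perp J1 :&: perp J2)%VS = chains_on U.
Proof.
move=> lJ1 lJ2 J12 dUT; have [/capv_idPl J1T _ _] := lJ1; have [J2T _ _] := lJ2.
rewrite (chains_on_capv_orthov lJ1 dUT) -vspace_modl; last first.
  exact: chains_on_orthogonal dUT J2T.
by rewrite -J1T -capvA (orthov_lagrangian_on lJ2) J12 addv0.
Qed.

Lemma lambda_reduction_submodular J1 J2 L T X Y :
    isotropic L -> lagrangian_on T J1 -> lagrangian_on T J2 ->
    (J1 :&: J2 = 0)%VS -> [disjoint X & T] -> [disjoint Y & T] ->
  (lambda L (X :&: Y) + lambda L (X :|: Y :|: T)
     <= lambda (reduction J1 L) X + lambda (reduction J2 L) Y + #|T|)%N.
Proof.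
move=> L0 lJ1 lJ2 J12 dXT dYT.
have dXYT : [disjoint X :|: Y & T].
  by rewrite -setI_eq0 setIUl !disjoint_setI0 ?setU0.
have dIT : [disjoint X :&: Y & T] by rewrite (disjointWl _ dXT) ?subsetIl.
pose W1 := (L :&: chains_on (X :|: T) :&: perp J1)%VS.
pose W2 := (L :&: chains_on (Y :|: T) :&: perp J2)%VS.
have sumW : (W1 + W2 <= L :&: chains_on (X :|: Y :|: T))%VS.
  rewrite subv_add; apply/andP; split; apply: subv_trans (capvSl _ _) _;
    by rewrite capvS // chains_onS // setSU ?subsetUl ?subsetUr.
have capW : (W1 :&: W2 <= L :&: chains_on (X :&: Y))%VS.
  rewrite -(chains_on_capv_orthov2 lJ1 lJ2 J12 dIT) setUIl -chains_onI.
  apply/subvP => f; rewrite !memv_cap.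
  by case/andP=> /andP[/andP[-> ->] ->] /andP[/andP[_ ->] ->].
have := leq_dim_reduction_capv L0 lJ1 dXT.
have := leq_dim_reduction_capv L0 lJ2 dYT; rewrite -/W1 -/W2.
have := dimv_sum_cap W1 W2; have := dimvS sumW; have := dimvS capW.
have := leq_dim_isotropic (X :&: Y) L0.
have := leq_dim_isotropic (X :|: Y :|: T) L0.
have := cardsUI X Y; have := cardsUI (X :|: Y) T.
by rewrite (disjoint_setI0 dXYT) cards0 /lambda; lia.
Qed.

(* A chain orthogonal to [axes A T] restricts to a chain of the minor that
   deletes [A] and contracts [T :\: A]. *)
Definition axes A T : {vspace ambient} :=
  (\sum_(x in T) <[single x (axis (x \in A)) : ambient]>)%VS.

Lemma eq_axes A B T : {in T, A =i B} -> axes A T = axes B T.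
Proof. by move=> AB; apply: eq_bigr => x /AB ->. Qed.

Lemma axesU A S T : axes A (S :|: T) = (axes A S + axes A T)%VS.
Proof. exact/big_setU/addvv. Qed.

Lemma orthov_axesP A T f :
  reflect {in T, forall x, formK skew (f x) (axis (x \in A)) = 0 :> F}
          (f \in perp (axes A T)).
Proof.
have single_perp x u :
    (<[single x u : ambient]> <= perp <[f]>)%VS = (formK skew (f x) u == 0).
  by rewrite orthov_sym orthov11 -ambient_form_single.
rewrite mem_orthov_sym; apply: (iffP subv_sumP) => f_perp x xT.
  by apply/eqP; rewrite -single_perp f_perp.
by rewrite single_perp f_perp.
Qed.

Lemma axis_neq0 b : axis b != 0.
Proof.
apply/eqP => /colP/(_ (if b then ord0 else ord_max))/eqP.
by rewrite mxE /axis; case: b; rewrite vec2E oner_eq0.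
Qed.

Lemma axis_isotropic b : formK skew (axis b) (axis b) = 0.
Proof. by apply/eqP; rewrite formK_axis /axis; case: b; rewrite vec2E. Qed.

Lemma axes_chains_on A T : (axes A T <= chains_on T)%VS.
Proof. by apply/subv_sumP => x xT; rewrite -memvE chains_on_single. Qed.

Lemma isotropic_axes A T : isotropic (axes A T).
Proof.
apply/subv_sumP => x xT; rewrite -memvE; apply/orthov_axesP => y yT.
by rewrite ffunE; case: eqP => [->|_]; [exact: axis_isotropic | exact: linear0l].
Qed.

Lemma dim_axes A T : \dim (axes A T) = #|T|.
Proof.
have single_neq0 x : single x (axis (x \in A)) != 0.
  apply: contraNneq (axis_neq0 (x \in A)) => /ffunP/(_ x).
  by rewrite !ffunE eqxx => ->.
rewrite (directvP _) /=.
  by rewrite -sum1_card; apply: eq_bigr => x _; rewrite dim_vline single_neq0.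
apply/directv_sum_independent => us us_line us0 x xT.
have us_out y z : y \in T -> z != y -> us y z = 0.
  by move=> /us_line/vlineP[a ->] zy; rewrite !ffunE (negbTE zy) scaler0.
apply/ffunP => z; rewrite [RHS]ffunE; have [->|/us_out->//] := eqVneq z x.
have /ffunP/(_ x) := us0; rewrite (bigD1 x) //= !ffunE sum_ffunE.
by rewrite big1 ?addr0 // => y /andP[yT yx]; rewrite us_out // eq_sym.
Qed.

Lemma lagrangian_axes A T : lagrangian_on T (axes A T).
Proof.
by split; [exact: axes_chains_on | exact: isotropic_axes | exact: dim_axes].
Qed.

Lemma reduction_axesU A S T L : [disjoint S & T] ->
  reduction (axes A (S :|: T)) L = reduction (axes A T) (reduction (axes A S) L).
Proof.
move=> dST; rewrite axesU reductionD // (subv_trans (axes_chains_on A S)) //.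
exact: chains_on_orthogonal dST (axes_chains_on A T).
Qed.

Lemma lambda_reduction_le A L T X Z :
    isotropic L -> [disjoint X & T] -> X \subset Z -> Z \subset X :|: T ->
  (lambda (reduction (axes A T) L) X <= lambda L Z)%N.
Proof.
move=> L0 dXT XZ ZXT; set J1 := axes A (T :&: Z); set J2 := axes A (T :\: Z).
have ZE : X :|: (T :&: Z) = Z.
  by rewrite -{1}(setIidPl XZ) -setIUl; apply/setIidPr.
have axesE : axes A T = (J1 + J2)%VS by rewrite -axesU setID.
have dXTZ : [disjoint X & T :&: Z] := disjointWr (subsetIl T Z) dXT.
have J1Z : (J1 <= chains_on Z)%VS.
  by rewrite (subv_trans (axes_chains_on _ _)) // chains_onS // subsetIr.
have redZ : (reduction J1 (L :&: chains_on Z)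
             <= reduction (axes A T) L :&: chains_on Z)%VS.
  rewrite subv_cap {2}reduction_capv // capvSr andbT axesE.
  rewrite (subv_trans _ (reductionS _ _ (capvSl L (chains_on Z)))) //.
  apply: reduction_addvS; apply: subv_trans (capvSr _ _) _.
  exact: chains_on_orthogonal (disjoint_setD Z T) (axes_chains_on _ _).
rewrite -(lambda_setU _ (lagrangian_axes A (T :&: Z)) _ dXTZ).
- rewrite ZE leq_sub2l // (leq_trans _ (dimvS redZ)) // leq_dim_reduction //.
  exact: isotropicS (capvSl _ _) L0.
- exact: isotropic_reduction (isotropic_axes _ _) L0.
- by rewrite (subv_trans _ (addvSr _ _)) // axesE addvSl.
Qed.

Lemma axes_complementary x :
  (axes setT [set x] :&: axes set0 [set x] = 0)%VS.
Proof.
apply/eqP; rewrite -subv0; apply/subvP => f.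
rewrite memv_cap memv0 => /andP[fT f0].
have /chains_onP f_out := subvP (axes_chains_on _ _) f fT.
have /orthov_axesP/(_ x (set11 x)) := subvP (isotropic_axes _ _) f fT.
have /orthov_axesP/(_ x (set11 x)) := subvP (isotropic_axes _ _) f f0.
rewrite !inE => f_perp0 f_perp1; apply/eqP/ffunP => y; rewrite [RHS]ffunE.
have [->|yx] := eqVneq y x; last by rewrite f_out ?inE.
by apply: formK_axis_nondegenerate => -[].
Qed.

Lemma exists_linked_reduction1 L X T v k :
    isotropic L -> [disjoint X & T] -> v \in T ->
    (forall Z, X \subset Z -> Z \subset X :|: T -> k <= lambda L Z)%N ->
  exists A, forall Z, X \subset Z -> Z \subset X :|: (T :\ v) ->
    (k <= lambda (reduction (axes A [set v]) L) Z)%N.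
Proof.
move=> L0 dXT vT kL.
pose linked A := [forall Z : {set E},
  (X \subset Z) && (Z \subset X :|: (T :\ v)) ==>
  (k <= lambda (reduction (axes A [set v]) L) Z)%N].
suff /orP[]: linked setT || linked set0.
- by move=> /forallP lk; exists setT => Z XZ ZT; have := lk Z; rewrite XZ ZT.
- by move=> /forallP lk; exists set0 => Z XZ ZT; have := lk Z; rewrite XZ ZT.
apply: contraT; rewrite negb_or !negb_forall => /andP[/existsP[Z1] + /existsP[Z2]].
rewrite !negb_imply -!ltnNge.
move=> /andP[/andP[XZ1 Z1T] Z1lt] /andP[/andP[XZ2 Z2T] Z2lt].
have vX : v \notin X by rewrite (disjointFl dXT).
have dv Z : Z \subset X :|: (T :\ v) -> [disjoint Z & [set v]].
  move=> ZT; rewrite disjoint_sym disjoints1; apply: contraNN vX => /(subsetP ZT).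
  by rewrite !inE eqxx orbF.
have := lambda_reduction_submodular L0 (lagrangian_axes setT [set v])
  (lagrangian_axes set0 [set v]) (axes_complementary v) (dv _ Z1T) (dv _ Z2T).
have XTS : X :|: (T :\ v) \subset X :|: T by rewrite setUS // subsetDl.
have Z1S := subset_trans Z1T XTS; have Z2S := subset_trans Z2T XTS.
have kI : (k <= lambda L (Z1 :&: Z2))%N.
  by apply: kL; rewrite ?subsetI ?XZ1 // subIset // Z1S.
have kU : (k <= lambda L (Z1 :|: Z2 :|: [set v]))%N.
  apply: kL; first by rewrite -setUA subsetU // XZ1.
  by rewrite !subUset Z1S Z2S sub1set inE vT orbT.
by rewrite cards1; lia.
Qed.

Lemma exists_linked_reduction L X T k :
    isotropic L -> [disjoint X & T] ->
    (forall Z, X \subset Z -> Z \subset X :|: T -> k <= lambda L Z)%N ->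
  exists A, (k <= lambda (reduction (axes A T) L) X)%N.
Proof.
elim: {T}_.+1 {-2}T (ltnSn #|T|) L => // n IH T Tn L L0 dXT kL.
have [T0|[v vT]] := set_0Vmem T.
  by exists set0; rewrite T0 /axes big_set0 reduction0v kL // subsetUl.
have [B kB] := exists_linked_reduction1 L0 dXT vT kL.
have LB0 := isotropic_reduction (isotropic_axes B [set v]) L0.
have [||A kA] := IH (T :\ v) _ _ LB0 _ kB.
- by rewrite (cardsD1 v) vT in Tn.
- exact: disjointWr (subsetDl _ _) dXT.
exists [set x in if x == v then B else A].
rewrite -(setD1K vT) reduction_axesU ?disjoints1 ?setD11 //.
rewrite (@eq_axes _ B [set v]) => [|x /set1P ->]; last by rewrite !inE eqxx.
rewrite (@eq_axes _ A (T :\ v)) // => x /setD1P[/negbTE xv _].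
by rewrite !inE xv.
Qed.

Lemma lagrangian_reduction S J L :
    (J <= chains_on S)%VS -> isotropic J -> lagrangian_on S L ->
  lagrangian_on S (reduction J L).
Proof.
move=> JS J0 [LS L0 dL].
have redS : (reduction J L <= chains_on S)%VS.
  by rewrite subv_add JS (subv_trans (capvSl _ _)).
have red0 := isotropic_reduction J0 L0; split=> //.
apply/eqP; rewrite eqn_leq -{2}dL leq_dim_reduction // andbT.
by rewrite -(capv_idPl redS) leq_dim_isotropic.
Qed.

Lemma lagrangian_capv S T J L :
    T \subset S -> lagrangian_on T J -> (J <= L)%VS -> lagrangian_on S L ->
  lagrangian_on (S :\: T) (L :&: chains_on (S :\: T)).
Proof.
move=> TS lJ JL [LS L0 dL]; split; first exact: capvSr.
  exact: isotropicS (capvSl _ _) L0.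
have dST : [disjoint S :\: T & T] by rewrite disjoint_sym disjoint_setD.
have := dim_capv_chains_onU L0 lJ JL dST.
have -> : S :\: T :|: T = S by rewrite setUC -{1}(setIidPr TS) setID.
rewrite (capv_idPl LS) dL cardsD (setIidPr TS); lia.
Qed.

(** * Minors of chain-groups *)

Lemma lagrangian_extend_group S (M : chain_group F S) :
  lagrangian skew M -> lagrangian_on S (extend_group M).
Proof.
case=> M0 dM; split; [exact: limgS (subvf M) | | by rewrite dim_extend_group].
apply/orthovP => _ _ /extend_groupP[f fM ->] /extend_groupP[g gM ->].
rewrite -[RHS](M0 f g fM gM) /= /ambient_form (bigID (mem S)) /=.
rewrite [X in _ + X]big1 => [|x xS]; last by rewrite extend_out ?linear0l.
by rewrite addr0 big_sub; apply: eq_bigr => y _; rewrite !extend_val.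
Qed.

Lemma extend_group_times S (M : chain_group F S) T :
  extend_group (cg_times M T) = (extend_group M :&: chains_on T)%VS.
Proof.
have extend_restrict_id (f : chain F S) :
    extend f \in chains_on T -> extend (restrict T f) = extend f.
  move=> /chains_onP f0; rewrite extend_restrict; apply/ffunP => x.
  by rewrite ffunE; case: ifPn => // /f0.
apply/vspaceP => g; rewrite memv_cap; apply/extend_groupP/andP.
  case=> _ /mem_cg_times[f [fM f0 ->]] ->.
  have fT : extend f \in chains_on T.
    apply/chains_onP => x xT; rewrite ffunE; case: insubP => // y _ yx.
    by rewrite f0 // yx.
  by rewrite extend_restrict_id //; split=> //; apply/extend_groupP; exists f.
case=> /extend_groupP[f fM ->] fT; exists (restrict T f).
  apply/mem_cg_times; exists f; split=> // y yT.
  by rewrite -extend_val (chains_onP _ _ fT).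
by rewrite extend_restrict_id.
Qed.

Lemma connectivity_lambda S (M : chain_group F S) U :
    lagrangian_on S (extend_group M) -> U \subset S ->
  connectivity M U = (lambda (extend_group M) U)%:R.
Proof.
move=> lM US; have [_ M0 dM] := lM.
apply: (canLR (mulfK _)); first by rewrite pnatr_eq0.
rewrite -!(dim_extend_group _) !extend_group_times dM.
have := lambda_complement lM US; rewrite /lambda.
have := leq_dim_isotropic U M0; have := leq_dim_isotropic (S :\: U) M0.
rewrite cardsD (setIidPr US); move: (\dim _) (\dim _) => a b lea leb lamE.
have -> : #|S| = (b + a + (#|U| - a) * 2)%N by have := subset_leq_card US; lia.
by rewrite !natrD natrM; ring.
Qed.

Lemma reduction_capvP J L S T g : lagrangian_on T J ->
  reflect (g \in chains_on (S :\: T) /\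
           exists2 f, f \in (L :&: perp J)%VS & f - g \in chains_on T)
          (g \in (reduction J L :&: chains_on (S :\: T))%VS).
Proof.
move=> lJ; have [JT _ _] := lJ; rewrite memv_cap.
apply: (iffP andP) => -[g1 g2]; last have [f fLJ fgT] := g2; split=> //.
- have [f fLJ [h hJ ->]] := memv_addP g1.
  by exists f; rewrite // opprD addNKr rpredN (subvP JT).
- rewrite -[g](subrK f) addrC memv_add // -opprB rpredN.
  rewrite -(orthov_lagrangian_on lJ) memv_cap fgT rpredB //.
    exact: (subvP (capvSr _ _) _ fLJ).
  apply: (subvP (chains_on_orthogonal _ JT)) g1.
  by rewrite disjoint_sym disjoint_setD.
Qed.

Lemma extend_restrictP S T (f : chain F S) g :
  g \in chains_on (S :\: T) ->
  reflect (g = extend (restrict (S :\: T) f)) (extend f - g \in chains_on T).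
Proof.
move=> /chains_onP g0; rewrite extend_restrict.
apply: (iffP (chains_onP _ _)) => [fgT|-> x xT].
  apply/ffunP => x; rewrite ffunE inE; have [xT|/fgT] /= := boolP (x \in T).
    by rewrite g0 // inE xT.
  rewrite !ffunE => /eqP; rewrite subr_eq0 => /eqP <-.
  by case: insubP => [y -> //|/negbTE ->].
rewrite !ffunE inE xT /=.
by case: insubP => [y -> _|/negbTE ->]; rewrite subrr.
Qed.

Lemma extend_group_minor_by (b : bool) A S (M : chain_group F S) T :
    {in T, forall x, (x \in A) = b} ->
  extend_group (cg_minor_by skew (axis b) M T)
  = (reduction (axes A T) (extend_group M) :&: chains_on (S :\: T))%VS.
Proof.
move=> Ab; have axes_orth (f : chain F S) :
    (extend f \in perp (axes A T)) <->
    (forall y : {x : E | x \in S}, val y \in T -> formK skew (f y) (axis b) = 0).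
  split=> [/orthov_axesP f0 y yT|f0].
    by rewrite -extend_val -(Ab _ yT) f0.
  apply/orthov_axesP => x xT; rewrite Ab // ffunE.
  by case: insubP => [y _ yx|_]; [apply: f0; rewrite yx | exact: linear0l].
have lA := lagrangian_axes A T.
apply/vspaceP => g; apply/extend_groupP/(reduction_capvP _ _ _ lA).
  case=> _ /mem_cg_minor_by[f [fM f0 ->]] ->.
  have fS : extend (restrict (S :\: T) f) \in chains_on (S :\: T).
    by apply/chains_onP => x; apply: extend_out.
  split=> //; exists (extend f); last exact/(extend_restrictP f fS).
  by apply/memv_capP; split; [apply/extend_groupP; exists f | apply/axes_orth].
case=> gS [_ /memv_capP[/extend_groupP[f fM ->] /axes_orth f0]].
move=> /(extend_restrictP f gS) gE.
by exists (restrict (S :\: T) f) => //; apply/mem_cg_minor_by; exists f.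
Qed.

Lemma extend_group_minor_by2 (b1 b2 : bool) A S (M : chain_group F S) T1 T2 :
    {in T1, forall x, (x \in A) = b1} -> {in T2, forall x, (x \in A) = b2} ->
    T2 \subset S -> [disjoint T1 & T2] ->
  extend_group (cg_minor_by skew (axis b2) (cg_minor_by skew (axis b1) M T1) T2)
  = (reduction (axes A (T1 :|: T2)) (extend_group M)
     :&: chains_on (S :\: (T1 :|: T2)))%VS.
Proof.
move=> Ab1 Ab2 T2S dT.
rewrite (extend_group_minor_by _ Ab2) (extend_group_minor_by _ Ab1).
rewrite reduction_axesU // reduction_capv -?capvA.
  by rewrite chains_onI setDDl (setIidPr _) // setDS // subsetUl.
rewrite (subv_trans (axes_chains_on _ _)) // chains_onS // subsetD T2S.
by rewrite disjoint_sym.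
Qed.

Lemma connectivity_minor_by2 (b1 b2 : bool) A S (N : chain_group F S) T1 T2 U :
    lagrangian skew N ->
    {in T1, forall x, (x \in A) = b1} -> {in T2, forall x, (x \in A) = b2} ->
    T1 \subset S -> T2 \subset S -> [disjoint T1 & T2] ->
    U \subset S :\: (T1 :|: T2) ->
  connectivity (cg_minor_by skew (axis b2) (cg_minor_by skew (axis b1) N T1) T2) U
  = (lambda (reduction (axes A (T1 :|: T2)) (extend_group N)) U)%:R.
Proof.
move=> lN Ab1 Ab2 T1S T2S dT UT; set T := T1 :|: T2.
have TS : T \subset S by rewrite subUset T1S.
have axesS : (axes A T <= chains_on S)%VS.
  exact: subv_trans (axes_chains_on A T) (chains_onS TS).
have lL := lagrangian_extend_group lN.
have lred := lagrangian_reduction axesS (isotropic_axes A T) lL.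
have lM := lagrangian_capv TS (lagrangian_axes A T) (addvSr _ _) lred.
have ME := extend_group_minor_by2 N Ab1 Ab2 T2S dT.
rewrite connectivity_lambda ?ME ?setDDl // /lambda -capvA chains_onI.
by rewrite (setIidPr UT).
Qed.

Lemma connectivity_contract_delete S (N : chain_group F S) A B U :
    lagrangian skew N -> A \subset S -> B \subset S -> [disjoint A & B] ->
    U \subset S :\: (A :|: B) ->
  connectivity (cg_contract skew (cg_delete skew N A) B) U
  = (lambda (reduction (axes A (A :|: B)) (extend_group N)) U)%:R.
Proof.
move=> lN AS BS dAB UAB.
apply: (@connectivity_minor_by2 true false) => // x xB.
by rewrite (disjointFl dAB).
Qed.

Lemma connectivity_delete_contract S (N : chain_group F S) A B U :
    lagrangian skew N -> A \subset S -> B \subset S -> [disjoint A & B] ->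
    U \subset S :\: (A :|: B) ->
  connectivity (cg_delete skew (cg_contract skew N B) A) U
  = connectivity (cg_contract skew (cg_delete skew N A) B) U.
Proof.
move=> lN AS BS dAB UAB; rewrite connectivity_contract_delete // setUC.
apply: (@connectivity_minor_by2 false true) => //.
- by move=> x xB; rewrite (disjointFl dAB).
- by rewrite disjoint_sym.
- by rewrite setUC.
Qed.

Lemma is_minor_connectivity S S' (N : chain_group F S) (M : chain_group F S') :
    lagrangian skew N -> is_minor skew N M ->
  exists A B, [/\ A \subset S, B \subset S, [disjoint A & B],
                  S' = S :\: (A :|: B)
                & forall U, U \subset S' -> connectivity M U
                    = connectivity (cg_contract skew (cg_delete skew N A) B) U].
Proof.
move=> lN [B A BS AS dBA]; rewrite disjoint_sym in dBA; exists A, B.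
split=> //; first by rewrite setDDl setUC.
by move=> U US; apply: connectivity_delete_contract; rewrite // setUC -setDDl.
Qed.

Lemma exists_minor_connectivity S S' (N : chain_group F S) A B :
    lagrangian skew N -> A \subset S -> B \subset S -> [disjoint A & B] ->
    S' = S :\: (A :|: B) ->
  exists2 M : chain_group F S', is_minor skew N M
    & forall U, U \subset S' -> connectivity M U
        = connectivity (cg_contract skew (cg_delete skew N A) B) U.
Proof.
move=> lN AS BS dAB; rewrite setUC -setDDl => ->.
exists (cg_delete skew (cg_contract skew N B) A).
  by apply: IsMinor; rewrite // disjoint_sym.
by move=> U US; apply: connectivity_delete_contract; rewrite // setUC -setDDl.
Qed.

Section Linking.
Variables (V X Y : {set E}) (N : chain_group F V).
Hypotheses (XV : X \subset V) (YV : Y \subset V) (dXY : [disjoint X & Y]).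
Hypothesis lN : lagrangian skew N.

Local Notation T := (V :\: (X :|: Y)).

Lemma setD_nonterminals : V :\: T = X :|: Y.
Proof. by rewrite setDDr setDv set0U; apply/setIidPr; rewrite subUset XV. Qed.

Lemma setD_terminal : V :\: Y = X :|: T.
Proof.
rewrite -{1}(setID (V :\: Y) X) setDDl (setUC Y); congr (_ :|: _).
by apply/setIidPr; rewrite subsetD XV.
Qed.

Lemma disjoint_nonterminals : [disjoint X & T].
Proof. by rewrite setUC -setDDl disjoint_setD. Qed.

Lemma connectivity_partition A B : A :|: B = T -> A :&: B = set0 ->
  connectivity (cg_contract skew (cg_delete skew N A) B) X
  = (lambda (reduction (axes A T) (extend_group N)) X)%:R.
Proof.
move=> AB AB0; rewrite -AB.
rewrite connectivity_contract_delete ?AB ?setD_nonterminals ?subsetUl //.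
- by rewrite (subset_trans (subsetUl A B)) // AB subsetDl.
- by rewrite (subset_trans (subsetUr A B)) // AB subsetDl.
- by rewrite -setI_eq0 AB0.
Qed.

Lemma connectivity_partition_le A B Z :
    A :|: B = T -> A :&: B = set0 -> X \subset Z -> Z \subset V :\: Y ->
  connectivity (cg_contract skew (cg_delete skew N A) B) X <= connectivity N Z.
Proof.
move=> AB AB0 XZ ZVY; have ZV := subset_trans ZVY (subsetDl V Y).
have lL := lagrangian_extend_group lN; have [_ L0 _] := lL.
rewrite connectivity_partition // (connectivity_lambda lL ZV).
by rewrite ler_nat lambda_reduction_le ?disjoint_nonterminals // -setD_terminal.
Qed.

Lemma exists_connectivity_partition_ge :
  exists Z A B, [/\ X \subset Z, Z \subset V :\: Y, A :|: B = T, A :&: B = set0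
    & connectivity N Z
      <= connectivity (cg_contract skew (cg_delete skew N A) B) X].
Proof.
have lL := lagrangian_extend_group lN; have [_ L0 _] := lL.
pose separating Z := (X \subset Z) && (Z \subset V :\: Y).
have sepX : separating X by rewrite /separating subxx setD_terminal subsetUl.
case: (arg_minnP (lambda (extend_group N)) sepX) => Z /andP[XZ ZVY] Zmin.
have [|A lamA] := exists_linked_reduction
  (k := lambda (extend_group N) Z) L0 disjoint_nonterminals.
  by move=> Z' XZ' Z'T; apply: Zmin; rewrite /separating XZ' setD_terminal.
have TA : T :&: A :|: T :\: A = T by rewrite setID.
have TA0 : (T :&: A) :&: (T :\: A) = set0.
  by apply/setP => x; rewrite !inE; case: (x \in A); rewrite ?andbF.
exists Z, (T :&: A), (T :\: A); split=> //.
have ZV := subset_trans ZVY (subsetDl V Y).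
rewrite connectivity_partition // (connectivity_lambda lL ZV) ler_nat.
by rewrite (@eq_axes _ A) // => x xT; rewrite inE xT.
Qed.

Lemma minor_connectivity_partition (M : chain_group F (X :|: Y)) :
    is_minor skew N M ->
  exists A B, [/\ A :|: B = T, A :&: B = set0
    & connectivity M X
      = connectivity (cg_contract skew (cg_delete skew N A) B) X].
Proof.
move=> /(is_minor_connectivity lN)[A [B [AV BV dAB XYE ->]]]; last exact: subsetUl.
exists A, B; split=> //; last exact: disjoint_setI0.
rewrite XYE setDDr setDv set0U; apply/esym/setIidPr.
by rewrite subUset AV.
Qed.

Lemma exists_minor_partition A B : A :|: B = T -> A :&: B = set0 ->
  exists2 M : chain_group F (X :|: Y), is_minor skew N M
    & connectivity M X
      = connectivity (cg_contract skew (cg_delete skew N A) B) X.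
Proof.
move=> AB AB0; have ABV : A :|: B \subset V by rewrite AB subsetDl.
have [||||M minM conM] := @exists_minor_connectivity V (X :|: Y) N A B lN.
- exact: subset_trans (subsetUl _ _) ABV.
- exact: subset_trans (subsetUr _ _) ABV.
- by rewrite -setI_eq0 AB0.
- by rewrite AB setD_nonterminals.
by exists M; rewrite ?conM ?subsetUl.
Qed.

End Linking.
End ChainGroups.

Theorem theorem5p3 (F : fieldType) (skew : bool) (E : finType)
    (V X Y : {set E}) (hXV : X \subset V) (hYV : Y \subset V)
    (hXY : [disjoint X & Y]) (N : chain_group F V)
    (hN : lagrangian skew N) :
  (forall k : rat,
     (forall Z : {set E}, X \subset Z -> Z \subset V :\: Y ->
        k <= connectivity N Z)
     <->
     (exists M : chain_group F (X :|: Y),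
        is_minor skew N M /\ k <= connectivity M X))
  /\
  \big[Order.min/connectivity N X]_(Z : {set E} |
      (X \subset Z) && (Z \subset V :\: Y)) connectivity N Z
  = \big[Order.max/connectivity
         (cg_contract skew (cg_delete skew N (V :\: (X :|: Y))) set0) X]_(
      p : {set E} * {set E} |
        (p.1 :|: p.2 == V :\: (X :|: Y)) && (p.1 :&: p.2 == set0))
      connectivity (cg_contract skew (cg_delete skew N p.1) p.2) X.
Proof.
have le_conn := connectivity_partition_le hXV hYV hXY hN.
have [Z0 [A [B [XZ0 Z0V AB AB0 Z0_le]]]] :=
  exists_connectivity_partition_ge hXV hYV hXY hN.
split=> [k|].
  split=> [k_le|[M [minM k_le]] Z XZ ZV].
    have [M minM ME] := exists_minor_partition hXV hYV hN AB AB0.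
    by exists M; rewrite ME (le_trans (k_le Z0 XZ0 Z0V)).
  have [A' [B' [AB' AB0' ME]]] := minor_connectivity_partition hN minM.
  by rewrite (le_trans k_le) // ME le_conn.
apply: (bigmin_eq_bigmax (i1 := Z0) (j1 := (A, B))
  (j0 := (V :\: (X :|: Y), set0))
  (g := fun p =>
     connectivity (cg_contract skew (cg_delete skew N p.1) p.2) X)) => //=.
- by rewrite subxx subsetD hXV.
- by rewrite XZ0.
- by rewrite setU0 setI0 !eqxx.
- by rewrite AB AB0 !eqxx.
- by move=> Z p /andP[XZ ZV] /andP[/eqP AB' /eqP AB0']; apply: le_conn.
Qed.
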